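(* Consider, for $d\in\mathbb{N}$, the optimization problem $\min_{x\in\mathcal{S}^{\downarrow}_d} f(x)$ with $f(x):=\frac12\|x\|^2$, and let $f^*$ be its optimal value. Any Frank-Wolfe-type method for this problem, when initialized with a standard basis vector $x_1=e_i$, $i\in\{1,\dots,d\}$, must perform in the worst case (over the valid outputs of the linear optimization oracle) $\Omega(d)$ steps to obtain approximation error lower than $1/d$. Precisely: there exist universal constants $c>0$ and $d_0\in\mathbb{N}$ such that for every $d\ge d_0$, every $i\in\{1,\dots,d\}$ and every Frank-Wolfe-type method initialized at $x_1=e_i$, there is a sequence of valid outputs $u_1,u_2,\dots$ of the linear optimization oracle for which the resulting iterates satisfy: every $t\ge1$ with $f(x_t)-f^*<1/d$ satisfies $t\ge c\,d$.
   Context: $\|\cdot\|$ is the Euclidean norm on $\mathbb{R}^d$ and $e_1,\dots,e_d$ is the standard basis. $\mathcal{S}^{\downarrow}_d:=\{x\in\mathbb{R}^d : x\ge 0,\ \sum_{i=1}^d x(i)\le 1\}$ is the down-closed unit simplex; its vertex set is $\mathcal{V}=\{0,e_1,\dots,e_d\}$. Frank-Wolfe-type method: an iterative algorithm for minimizing a differentiable function $f$ over a polytope with vertex set $\mathcal{V}$ such that on each iteration $t\ge1$ it performs a single call to the linear optimization oracle at $\nabla f(x_t)$, where $x_t$ is the current iterate, receiving some $u_t\in\arg\min_{v\in\mathcal{V}}v^{\top}\nabla f(x_t)$, and then produces the next iterate $x_{t+1}$ as some convex combination of the points in $\{x_1,u_1,\dots,u_t\}$, where $x_1$ is the initialization point.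 The rule by which the method selects the convex combination is arbitrary and may depend on the whole history. When the minimizer defining $u_t$ is not unique, any minimizer is a valid output of the oracle. *)

(* Defs.v *)
From HB Require Import structures.
From mathcomp Require Import all_boot all_order all_algebra.
From mathcomp Require Import boolp classical_sets reals topology normedtype derive.

Set Implicit Arguments.
Unset Strict Implicit.
Unset Printing Implicit Defensive.

Import Order.TTheory GRing.Theory Num.Theory.
Import numFieldNormedType.Exports.

Local Open Scope classical_set_scope.
Local Open Scope ring_scope.

(* Points of R^d are row vectors; the library norm on 'rV[R]_d is the sup
   norm, hence the separate Euclidean norm. *)
Definition dotv (R : realType) (d : nat) (x y : 'rV[R]_d) : R :=
  \sum_(j < d) x 0 j * y 0 j.

Definition enorm (R : realType) (d : nat) (x : 'rV[R]_d) : R :=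
  Num.sqrt (dotv x x).

Definition basis_vec (R : realType) (d : nat) (i : 'I_d) : 'rV[R]_d :=
  delta_mx 0 i.

Definition gradient (R : realType) (d : nat) (f : 'rV[R]_d -> R)
    (x : 'rV[R]_d) : 'rV[R]_d :=
  \row_(j < d) 'D_(basis_vec R j) f x.

Definition is_convex_comb (R : realType) (d : nat) (s : seq 'rV[R]_d)
    (x : 'rV[R]_d) : Prop :=
  exists w : 'I_(size s) -> R,
    [/\ forall k, 0 <= w k, \sum_k w k = 1 & x = \sum_k w k *: s`_k].

Definition lmo (R : realType) (d : nat) (V : set 'rV[R]_d) (g : 'rV[R]_d) :
    set 'rV[R]_d :=
  [set u | V u /\ forall v, V v -> dotv u g <= dotv v g].

(* A selection rule maps the list [u_1; ...; u_t] of oracle outputs received so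
   far to x_{t+1}.  Since x_1, ..., x_t are themselves determined by these
   outputs, such a rule may depend on the whole history. *)
Definition rule (R : realType) (d : nat) : Type := seq 'rV[R]_d -> 'rV[R]_d.

(* Oracle outputs and iterates are numbered from 1; the value u 0 is unused. *)
Definition outputs (R : realType) (d : nat) (u : nat -> 'rV[R]_d) (t : nat) :
    seq 'rV[R]_d :=
  [seq u s | s <- iota 1 t].

Definition iterate (R : realType) (d : nat) (A : rule R d)
    (u : nat -> 'rV[R]_d) (t : nat) : 'rV[R]_d :=
  A (outputs u t.-1).

Definition valid_output (R : realType) (d : nat) (f : 'rV[R]_d -> R)
    (V : set 'rV[R]_d) (A : rule R d) (u : nat -> 'rV[R]_d) (t : nat) : Prop :=
  lmo V (gradient f (iterate A u t)) (u t).

(* The rule is only constrained on histories that can actually arise, i.e. those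
   whose outputs u_1, ..., u_t are all valid. *)
Definition frank_wolfe_type (R : realType) (d : nat) (f : 'rV[R]_d -> R)
    (V : set 'rV[R]_d) (x1 : 'rV[R]_d) (A : rule R d) : Prop :=
  (forall u, iterate A u 1 = x1) /\
  (forall u t, (1 <= t)%N ->
     (forall s, (1 <= s <= t)%N -> valid_output f V A u s) ->
     is_convex_comb (x1 :: outputs u t) (iterate A u t.+1)).

Definition down_simplex (R : realType) (d : nat) : set 'rV[R]_d :=
  [set x | (forall j, 0 <= x 0 j) /\ \sum_(j < d) x 0 j <= 1].

Definition down_simplex_vertices (R : realType) (d : nat) : set 'rV[R]_d :=
  [set v | v = 0 \/ exists j : 'I_d, v = basis_vec R j].

Definition half_sqnorm (R : realType) (d : nat) (x : 'rV[R]_d) : R :=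
  2^-1 * enorm x ^+ 2.

Definition opt_value (R : realType) (d : nat) (f : 'rV[R]_d -> R)
    (S : set 'rV[R]_d) : R :=
  inf (f @` S).

(* Main.v *)
Require Import Defs.
From HB Require Import structures.
From mathcomp Require Import all_boot all_order all_algebra.
From mathcomp Require Import boolp classical_sets reals topology normedtype derive.
From mathcomp Require Import ring lra.

Set Implicit Arguments.
Unset Strict Implicit.
Unset Printing Implicit Defensive.

Import Order.TTheory GRing.Theory Num.Theory.
Import numFieldNormedType.Exports.
Local Open Scope ring_scope.

(** The gradient of [half_sqnorm] at [x] is [x] itself, and every iterate [x]
    has nonnegative coordinates, so a vertex is a valid oracle output as soon
    as it is orthogonal to [x]: the minimum over the vertices is 0, attained
    at the vertex 0 and at every [e_j] with [x 0 j = 0].  The oracle can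
    therefore answer with a basis vector that has never appeared before, as
    long as one is left.  Enumerating the basis cyclically from [i], the
    answers [e_(i+1), e_(i+2), ...] (indices modulo [d]) are valid for the
    first [d - 1] steps whatever the method does, and so is 0 afterwards: the
    bad sequence depends neither on the rule nor on the iterates
    ([fresh_vertices_valid]).

    Up to step [d] the iterate [x_t] is then a convex combination of [t]
    distinct basis vectors.  Its coordinates sum to 1 and at most [t] of them
    are nonzero, so the Cauchy-Schwarz inequality gives [1 <= t * |x_t|^2]
    ([sqnorm_sparse_ge]).  Since the optimal value is at most 0, an error below
    [1/d] forces [1/(2t) < 1/d], that is [d/2 < t]; steps [t > d] satisfy this
    trivially.  Hence [c = 1/2] works for all [d]. *)

Section EuclideanPreliminaries.
Variables (R : realType) (d : nat).
Implicit Types x g : 'rV[R]_d.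

Lemma dotv0l x : dotv 0 x = 0.
Proof. by rewrite /dotv big1 // => j _; rewrite mxE mul0r. Qed.

Lemma dotv_basis_vecl (j : 'I_d) x : dotv (basis_vec R j) x = x 0 j.
Proof.
rewrite /dotv (bigD1 j) //= /basis_vec mxE !eqxx mul1r big1 ?addr0 // => k kj.
by rewrite mxE (negPf kj) andbF mul0r.
Qed.

Lemma dotvC x g : dotv x g = dotv g x.
Proof. by apply: eq_bigr => j _; rewrite mulrC. Qed.

Lemma dotv_basis_vecr x (j : 'I_d) : dotv x (basis_vec R j) = x 0 j.
Proof. by rewrite dotvC dotv_basis_vecl. Qed.

Lemma dotvNr x g : dotv x (- g) = - dotv x g.
Proof. by rewrite /dotv -sumrN; apply: eq_bigr => j _; rewrite mxE mulrN. Qed.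

Lemma dotvv_ge0 x : 0 <= dotv x x.
Proof. by apply: sumr_ge0 => j _; rewrite -expr2 sqr_ge0. Qed.

Lemma half_sqnormE x : half_sqnorm x = 2^-1 * dotv x x.
Proof. by rewrite /half_sqnorm /enorm sqr_sqrtr // dotvv_ge0. Qed.

Lemma half_sqnormD_basis (h : R) (j : 'I_d) x :
  half_sqnorm (h *: basis_vec R j + x)
    = half_sqnorm x + h * x 0 j + 2^-1 * h ^+ 2.
Proof.
have -> : half_sqnorm (h *: basis_vec R j + x) =
    2^-1 * (h ^+ 2 * dotv (basis_vec R j) (basis_vec R j)
            + 2 * h * dotv (basis_vec R j) x + dotv x x).
  rewrite half_sqnormE /dotv !mulr_sumr -!big_split /= mulr_sumr.
  by apply: eq_bigr => k _; rewrite !mxE; ring.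
rewrite half_sqnormE !dotv_basis_vecl /basis_vec mxE !eqxx /=.
by field.
Qed.

(** Along a coordinate line the difference quotient is exactly
    [x 0 j + h / 2]. *)
Lemma gradient_half_sqnorm x : gradient (@half_sqnorm R d) x = x.
Proof.
apply/rowP => j; rewrite mxE /derive.
have qE : {near dnbhs (0 : R),
    (fun h : R => x 0 j + 2^-1 * h) =1
    (fun h : R => h^-1 *: (half_sqnorm (h *: basis_vec R j + x)
                           - half_sqnorm x))}.
  near=> h.
  have h0 : h != 0 by near: h; exact: nbhs_dnbhs_neq.
  rewrite half_sqnormD_basis /GRing.scale /=.
  by field.
apply: cvg_lim => //.
apply: cvg_trans (near_eq_cvg qE) _.
apply: cvg_within_filter.
have lim0 : ((fun h : R => x 0 j + 2^-1 * h) @ nbhs (0 : R)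
             --> x 0 j + 2^-1 * 0)%classic.
  apply: cvgD; first exact: cvg_cst.
  by apply: cvgM; [exact: cvg_cst|exact: cvg_id].
by rewrite mulr0 addr0 in lim0.
Unshelve. all: by end_near. Qed.

Lemma opt_value_half_sqnorm_le0 :
  opt_value (@half_sqnorm R d) (@down_simplex R d) <= 0.
Proof.
apply: ge_inf.
  exists 0 => _ [x _ <-].
  by rewrite half_sqnormE mulr_ge0 ?dotvv_ge0 // invr_ge0.
exists 0; last by rewrite half_sqnormE dotv0l mulr0.
by split=> [j|]; rewrite ?big1 // => *; rewrite mxE.
Qed.

(** The Cauchy-Schwarz inequality on [S], obtained by summing the tangent
    inequality [(t * x_j - 1)^2 >= 0] over [S]. *)
Lemma sqnorm_sparse_ge x (S : {set 'I_d}) (t : nat) :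
  (forall j, j \notin S -> x 0 j = 0) -> \sum_j x 0 j = 1 -> (#|S| <= t)%N ->
  1 <= t%:R * dotv x x.
Proof.
move=> supp sum1 cardS.
have sumS : \sum_(j in S) x 0 j = 1.
  by rewrite -sum1 [RHS](bigID (mem S)) /= [X in _ + X]big1 ?addr0.
have dotS : dotv x x = \sum_(j in S) x 0 j * x 0 j.
  rewrite /dotv (bigID (mem S)) /= [X in _ + X]big1 ?addr0 // => j jS.
  by rewrite supp // mul0r.
have St : #|S|%:R <= t%:R :> R by rewrite ler_nat.
have t_gt0 : 0 < t%:R :> R.
  rewrite ltr0n (leq_trans _ cardS) // card_gt0; apply/eqP => S0.
  by move/eqP: sumS; rewrite S0 big_set0 eq_sym oner_eq0.
have : 0 <= \sum_(j in S) (t%:R * x 0 j - 1) ^+ 2.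
  by apply: sumr_ge0 => j _; rewrite sqr_ge0.
have -> : \sum_(j in S) (t%:R * x 0 j - 1) ^+ 2
    = t%:R ^+ 2 * dotv x x - 2 * t%:R + #|S|%:R.
  transitivity (t%:R ^+ 2 * dotv x x - 2 * t%:R * (\sum_(j in S) x 0 j)
                + \sum_(j in S) (1 : R)); last by rewrite sumS mulr1 sumr_const.
  rewrite dotS !mulr_sumr -sumrN -!big_split /=.
  by apply: eq_bigr => j _; ring.
move=> sq_ge0.
by rewrite -(ler_pM2l t_gt0); lra.
Qed.

End EuclideanPreliminaries.

Section ConvexCombinations.
Variables (R : realType) (d : nat).
Implicit Types (s : seq 'rV[R]_d) (x g : 'rV[R]_d).

Lemma convex_comb_seq1 x : is_convex_comb [:: x] x.
Proof.
by exists (fun=> 1); split=> [//||]; rewrite big_ord1 //= scale1r.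
Qed.

(** Everything needed about the iterates (sign, vanishing and sum of their
    coordinates) is a bound on a linear functional, hence inherited from the
    points being combined. *)
Lemma convex_comb_dotv_ge s x g (a : R) :
  is_convex_comb s x -> (forall v, v \in s -> a <= dotv v g) -> a <= dotv x g.
Proof.
move=> [w [w_ge0 w_sum1 ->]] s_ge.
have -> : dotv (\sum_k w k *: s`_k) g = \sum_k w k * dotv s`_k g.
  under [RHS]eq_bigr do rewrite mulr_sumr.
  rewrite exchange_big; apply: eq_bigr => j _.
  by rewrite summxE mulr_suml; apply: eq_bigr => k _; rewrite mxE mulrA.
rewrite -[a]mul1r -w_sum1 mulr_suml; apply: ler_sum => k _.
by rewrite ler_wpM2l // s_ge // mem_nth.
Qed.

Lemma convex_comb_dotv_eq s x g (a : R) :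
  is_convex_comb s x -> (forall v, v \in s -> dotv v g = a) -> dotv x g = a.
Proof.
move=> sx s_eq; apply/le_anti/andP; split.
  rewrite -lerN2 -dotvNr; apply: convex_comb_dotv_ge sx _ => v vs.
  by rewrite dotvNr s_eq.
by apply: convex_comb_dotv_ge sx _ => v vs; rewrite s_eq.
Qed.

End ConvexCombinations.

Section FreshVertices.
Variables (R : realType) (d : nat) (i : 'I_d).

Definition cyclic_shift (t : nat) : 'I_d :=
  Ordinal (ltn_pmod (i + t) (leq_ltn_trans (leq0n i) (ltn_ord i))).

(** Starting the enumeration at [fresh_vertex 0 = e_i] makes the points
    available for the iterate [t + 1], initialization included, the values of
    this one sequence at [0, ..., t]. *)
Definition fresh_vertex (t : nat) : 'rV[R]_d :=
  if (t < d)%N then basis_vec R (cyclic_shift t) else 0.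

Lemma cyclic_shift0 : cyclic_shift 0 = i.
Proof. by apply: val_inj; rewrite /= addn0 modn_small. Qed.

Lemma cyclic_shift_inj (s t : nat) :
  (s < d)%N -> (t < d)%N -> cyclic_shift s = cyclic_shift t -> s = t.
Proof.
move=> sd td /(congr1 val) /= /eqP.
by rewrite eqn_modDl !modn_small // => /eqP.
Qed.

Lemma fresh_vertex0 : fresh_vertex 0 = basis_vec R i.
Proof.
by rewrite /fresh_vertex (leq_ltn_trans (leq0n i) (ltn_ord i)) cyclic_shift0.
Qed.

Lemma fresh_vertex_ge0 (t : nat) (j : 'I_d) : 0 <= fresh_vertex t 0 j.
Proof. by rewrite /fresh_vertex; case: ifP; rewrite mxE. Qed.

Lemma fresh_vertex_shift_eq0 (s t : nat) :
  (s < t)%N -> (t < d)%N -> fresh_vertex s 0 (cyclic_shift t) = 0.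
Proof.
move=> st td; have sd := ltn_trans st td.
rewrite /fresh_vertex sd mxE eqxx /=; case: eqP => // ts.
by move: st; rewrite (cyclic_shift_inj td sd ts) ltnn.
Qed.

Lemma fresh_vertex_in_vertices (t : nat) :
  @down_simplex_vertices R d (fresh_vertex t).
Proof.
by rewrite /fresh_vertex; case: ifP => _; [right; exists (cyclic_shift t)|left].
Qed.

Variable A : rule R d.
Hypothesis fwA : frank_wolfe_type (@half_sqnorm R d)
  (@down_simplex_vertices R d) (basis_vec R i) A.

Let valid (t : nat) := valid_output (@half_sqnorm R d)
  (@down_simplex_vertices R d) A fresh_vertex t.

Let iterate_convex_comb_if (t : nat) : (1 <= t)%N ->
  (forall s, (1 <= s < t)%N -> valid s) ->
  is_convex_comb [seq fresh_vertex s | s <- iota 0 t]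
    (iterate A fresh_vertex t).
Proof.
case: fwA => A1 Astep; case: t => [//|[|t]] _ vs.
  by rewrite /= fresh_vertex0 A1; exact: convex_comb_seq1.
by have := Astep fresh_vertex t.+1 isT vs; rewrite -fresh_vertex0.
Qed.

(** Both kinds of answers are orthogonal to the current iterate: the new basis
    vector because no point combined so far has weight on its coordinate, and
    0 trivially. *)
Lemma fresh_vertices_valid (t : nat) : (1 <= t)%N -> valid t.
Proof.
elim/ltn_ind: t => t IH t1.
have comb : is_convex_comb [seq fresh_vertex s | s <- iota 0 t]
    (iterate A fresh_vertex t).
  by apply: iterate_convex_comb_if => // s /andP[s1 st]; exact: IH.
have x_ge0 j : 0 <= iterate A fresh_vertex t 0 j.
  rewrite -dotv_basis_vecr; apply: convex_comb_dotv_ge comb _ => _ /mapP[s _ ->].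
  by rewrite dotv_basis_vecr fresh_vertex_ge0.
have orth : dotv (fresh_vertex t) (iterate A fresh_vertex t) = 0.
  have [td|dt] := ltnP t d; last by rewrite /fresh_vertex ltnNge dt dotv0l.
  rewrite {1}/fresh_vertex td dotvC; apply: convex_comb_dotv_eq comb _.
  move=> _ /mapP[s + ->]; rewrite mem_iota => /= st.
  by rewrite dotv_basis_vecr fresh_vertex_shift_eq0.
rewrite /valid /valid_output gradient_half_sqnorm.
split; first exact: fresh_vertex_in_vertices.
by move=> _ [->|[j ->]]; rewrite orth ?dotv0l ?dotv_basis_vecl.
Qed.

Lemma iterate_convex_comb (t : nat) : (1 <= t)%N ->
  is_convex_comb [seq fresh_vertex s | s <- iota 0 t]
    (iterate A fresh_vertex t).
Proof.
move=> t1; apply: iterate_convex_comb_if => // s /andP[s1 _].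
exact: fresh_vertices_valid.
Qed.

Lemma iterate_sqnorm_ge (t : nat) : (1 <= t <= d)%N ->
  1 <= t%:R * dotv (iterate A fresh_vertex t) (iterate A fresh_vertex t).
Proof.
move=> /andP[t1 td]; have comb := iterate_convex_comb t1.
have freshE s : s \in iota 0 t -> fresh_vertex s = basis_vec R (cyclic_shift s).
  rewrite mem_iota /= => st.
  by rewrite /fresh_vertex (leq_trans st td).
pose S := [set cyclic_shift s | s : 'I_t].
apply: (@sqnorm_sparse_ge _ _ _ S); last first.
- by rewrite (leq_trans (leq_imset_card _ _)) // card_ord.
- have -> : \sum_j iterate A fresh_vertex t 0 j
      = dotv (iterate A fresh_vertex t) (const_mx 1).
    by apply: eq_bigr => j _; rewrite mxE mulr1.
  apply: convex_comb_dotv_eq comb _ => _ /mapP[s /freshE-> ->].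
  by rewrite dotv_basis_vecl mxE.
move=> j jS; rewrite -dotv_basis_vecr; apply: convex_comb_dotv_eq comb _.
move=> _ /mapP[s sI ->]; rewrite freshE // dotv_basis_vecr mxE /=.
case: eqP => // js; case/negP: jS.
have st : (s < t)%N by move: sI; rewrite mem_iota.
by rewrite js; apply/imsetP; exists (Ordinal st).
Qed.

End FreshVertices.

Theorem theorem2 (R : realType) :
  exists (c : R) (d0 : nat), 0 < c /\
    forall d : nat, (d0 <= d)%N ->
    forall (i : 'I_d) (A : rule R d),
      frank_wolfe_type (@half_sqnorm R d) (@down_simplex_vertices R d)
        (basis_vec R i) A ->
      exists u : nat -> 'rV[R]_d,
        (forall t : nat, (1 <= t)%N ->
           valid_output (@half_sqnorm R d) (@down_simplex_vertices R d) A u t) /\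
        (forall t : nat, (1 <= t)%N ->
           half_sqnorm (iterate A u t)
             - opt_value (@half_sqnorm R d) (@down_simplex R d) < d%:R^-1 ->
           c * d%:R <= t%:R).
Proof.
exists 2^-1, 0%N; split; first by rewrite invr_gt0.
move=> d _ i A fwA; exists (fresh_vertex R i); split.
  exact: fresh_vertices_valid.
move=> t t1 err.
have d_gt0 : 0 < d%:R :> R.
  by rewrite ltr0n (leq_ltn_trans (leq0n i) (ltn_ord i)).
have t_gt0 : 0 < t%:R :> R by rewrite ltr0n.
have [td|/ltnW dt] := leqP t d; last first.
  by move: dt; rewrite -(ler_nat R); lra.
have sq_ge : 1 <= t%:R * dotv (iterate A (fresh_vertex R i) t)
    (iterate A (fresh_vertex R i) t).
  by apply: iterate_sqnorm_ge => //; rewrite t1.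
have sq_lt : dotv (iterate A (fresh_vertex R i) t)
    (iterate A (fresh_vertex R i) t) < 2 * d%:R^-1.
  by move: err (opt_value_half_sqnorm_le0 R d); rewrite half_sqnormE; lra.
have : 1 < t%:R * (2 * d%:R^-1) :> R.
  by apply: le_lt_trans sq_ge _; rewrite ltr_pM2l.
by rewrite mulrA ltr_pdivlMr // mul1r; lra.
Qed.
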